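(* Let $V\subseteq\mathbb R$, $(\Omega,\Psi(z)dz)$ a probability space, and for each $z$ let $f_\epsilon(t,\cdot,z)$ and $\tilde f(t,\cdot,z)$ be probability densities on $V$ at a fixed time $t$. Let $S_{\Delta w}\ge0$ be a bounded measurable smoothing kernel with mesh size $\Delta w>0$, and for $w\in V$ set $(S,g)(t,w,z):=\int_V S_{\Delta w}(w-v)g(t,v,z)\,dv$; assume $\mathrm{Var}[(S,\tilde f)(t,w,\cdot)]>0$ and $\mathrm{Var}[(S,f_\epsilon)(t,w,\cdot)]>0$ for every $w$. Let $z_1,\dots,z_M$ be i.i.d. with density $\Psi$ and, conditionally on them, for each $k$ let $w_1(t,z_k),\dots,w_N(t,z_k)$ be i.i.d. with law $f_\epsilon(t,\cdot,z_k)$, independent across $k$; let $f_{\epsilon,N,\Delta w}(t,w,z_k)=\frac1N\sum_{i=1}^NS_{\Delta w}(w-w_i(t,z_k))$. For each $w$ let $\lambda^*(w)=\mathrm{Cov}[(S,f_\epsilon),(S,\tilde f)]/\mathrm{Var}[(S,\tilde f)]$ and $$E^{\lambda^*}_M[f_{\epsilon,N,\Delta w}](t,w)=\frac1M\sum_{k=1}^Mf_{\epsilon,N,\Delta w}(t,w,z_k)-\lambda^*(w)\Big(\frac1M\sum_{k=1}^M(S,\tilde f)(t,w,z_k)-\mathbb E[(S,\tilde f)(t,w,\cdot)]\Big).$$ Assume that for some $1\le p\le\infty$, $q>0$ and constant $C_{\mathbb E[f]}$, $\|\mathbb E[f_\epsilon](t,\cdot)-\mathbb E[(S,f_\epsilon)](t,\cdot)\|_{L^p(V)}\le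 C_{\mathbb E[f]}(\Delta w)^q$. Then $$\big\|\mathbb E[f_\epsilon](t,\cdot)-E^{\lambda^*}_M[f_{\epsilon,N,\Delta w}](t,\cdot)\big\|_{L^p(V,L^2(\Omega,L^2(V)))}\le\frac{\Big\|\big(1-\rho^2_{(S,f_\epsilon),(S,\tilde f)}\big)^{1/2}\nu_{(S,f_\epsilon)}\Big\|_{L^p(V)}}{M^{1/2}}+\frac{\|\sigma_{S,M}\|_{L^p(V)}}{N^{1/2}}+C_{\mathbb E[f]}(\Delta w)^q.$$
   Context: $f_\epsilon$ is the solution of a Boltzmann-type kinetic model with uncertain parameter $z$ and $\tilde f$ the solution of its mean-field (Fokker–Planck) approximation, whose values are assumed computed exactly. Notation: $\mathbb E,\mathrm{Var},\mathrm{Cov}$ are with respect to $z\sim\Psi$ (over the i.i.d. parameter samples where applicable); $\mathbb E_V$ is expectation over the particle samples. For a random function $g(w)$, $\|g\|_{L^p(V,L^2(\Omega,L^2(V)))}:=\big\|\,\mathbb E[\mathbb E_V[g^2]]^{1/2}\big\|_{L^p(V)}$. For $w\in V$: $\nu^2_{(S,f_\epsilon)}(t,w)=\mathrm{Var}[(S,f_\epsilon)(t,w,\cdot)]$; $\rho_{(S,f_\epsilon),(S,\tilde f)}(t,w)$ is the Pearson correlation coefficient in $z$ between $(S,f_\epsilon)(t,w,\cdot)$ and $(S,\tilde f)(t,w,\cdot)$; $\sigma_S^2(t,w,z)=\int_V\big(S_{\Delta w}(w-v)-(S,f_\epsilon)(t,w,z)\big)^2f_\epsilon(t,v,z)\,dv$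 and $\sigma^2_{S,M}(t,w)=\mathbb E[\sigma_S^2(t,w,\cdot)]$. *)

(* Defs.v *)
From HB Require Import structures.
From mathcomp Require Import all_boot all_order all_algebra.
From mathcomp Require Import all_classical all_reals all_analysis.
Set Implicit Arguments. Unset Strict Implicit. Unset Printing Implicit Defensive.
Import Order.TTheory GRing.Theory Num.Theory.
Local Open Scope classical_set_scope.
Local Open Scope ring_scope.

Section kinetic_mc.
Context {R : realType} {d : measure_display} {Omega : measurableType d}.
Local Notation leb := (@lebesgue_measure R).

Definition is_density_on (V : set R) (g : R -> R) : Prop :=
  [/\ measurable_fun setT g, (forall v, 0 <= g v)
    & (\int[leb]_(v in V) (g v)%:E = 1)%E].

(* (S,g)(w,z) := \int_V S(w - v) g(v,z) dv   (time t fixed and omitted) *)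
Definition smooth (S : R -> R) (V : set R) (g : R -> Omega -> R)
    (w : R) (z : Omega) : R :=
  fine (\int[leb]_(v in V) (S (w - v) * g v z)%:E).

Definition nu2 (P : probability Omega R) S V (f : R -> Omega -> R) (w : R) : R :=
  fine ('V_P[smooth S V f w]).

Definition rho (P : probability Omega R) S V (f ft : R -> Omega -> R) (w : R) : R :=
  fine (covariance P (smooth S V f w) (smooth S V ft w))
  / (Num.sqrt (nu2 P S V f w) * Num.sqrt (nu2 P S V ft w)).

Definition lambda_star (P : probability Omega R) S V (f ft : R -> Omega -> R)
    (w : R) : R :=
  fine (covariance P (smooth S V f w) (smooth S V ft w))
  / fine ('V_P[smooth S V ft w]).

Definition sigma2_S S V (f : R -> Omega -> R) (w : R) (z : Omega) : R :=
  fine (\int[leb]_(v in V) ((S (w - v) - smooth S V f w z) ^+ 2 * f v z)%:E).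

Definition sigma2_SM (P : probability Omega R) S V (f : R -> Omega -> R)
    (w : R) : \bar R :=
  'E_P[sigma2_S S V f w].

Definition LpV (V : set R) (p : \bar R) (g : R -> \bar R) : \bar R :=
  Lnorm leb p (fun w => ((\1_V w : R)%:E * g w)%E).

(* Sampling scheme on an abstract probability space (Sigma, Q):
   Z k (k < M) i.i.d. with law P, and conditionally on the Z's the W k i
   (i < N) are independent with law f(.,Z k) dv on V, independently across k.
   This is expressed by the joint law on measurable rectangles. *)
Definition is_sampling {dS : measure_display} {Sigma : measurableType dS}
    (Q : probability Sigma R) (P : probability Omega R) (V : set R)
    (f : R -> Omega -> R) (M N : nat)
    (Z : 'I_M -> Sigma -> Omega) (W : 'I_M -> 'I_N -> Sigma -> R) : Prop :=
  [/\ (forall k, measurable_fun setT (Z k)),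
      (forall k i, measurable_fun setT (W k i))
    & forall (A : 'I_M -> set Omega) (B : 'I_M -> 'I_N -> set R),
        (forall k, measurable (A k)) -> (forall k i, measurable (B k i)) ->
        Q (\bigcap_(k in [set: 'I_M])
             (Z k @^-1` A k `&` \bigcap_(i in [set: 'I_N]) (W k i @^-1` B k i)))
        = (\prod_(k < M)
             \int[P]_(z in A k) \prod_(i < N)
                \int[leb]_(v in B k i `&` V) (f v z)%:E)%E].

Definition fN {Sigma : Type} (S : R -> R) (M N : nat)
    (W : 'I_M -> 'I_N -> Sigma -> R) (w : R) (k : 'I_M) (s : Sigma) : R :=
  (N%:R)^-1 * \sum_(i < N) S (w - W k i s).

Definition estimator {Sigma : Type} (P : probability Omega R) S V
    (f ft : R -> Omega -> R) (M N : nat)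
    (Z : 'I_M -> Sigma -> Omega) (W : 'I_M -> 'I_N -> Sigma -> R)
    (w : R) (s : Sigma) : R :=
  (M%:R)^-1 * \sum_(k < M) fN S W w k s
  - lambda_star P S V f ft w *
      ((M%:R)^-1 * \sum_(k < M) smooth S V ft w (Z k s)
       - fine ('E_P[smooth S V ft w])).

End kinetic_mc.

(* Main.v *)
Require Import Defs.
From HB Require Import structures.
From mathcomp Require Import all_boot all_order all_algebra.
From mathcomp Require Import all_classical all_reals all_analysis.
From mathcomp Require Import measurable_realfun ess_sup_inf.
From mathcomp Require Import ring lra.
Import Order.TTheory GRing.Theory Num.Theory.
Local Open Scope classical_set_scope.
Local Open Scope ring_scope.
Set Implicit Arguments.
Unset Strict Implicit.
Unset Printing Implicit Defensive.

(* Fix [w], write [x], [y] for [(S,ft)(w,.)], [(S,f)(w,.)] and [l] for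
   [lambda_star].  The error is the bias [E f - E y] minus the average over
   [k], [i] of the centred variables
     [G k i = S (w - W k i) - l * x (Z k) - (E y - l * E x)].
   Conditioning on the [Z k] gives
     [E (G k i * G m j) = [k = m] * (tau + [i = j] * sigma^2)],
   where [tau], the residual variance of the regression of [y] on [x], equals
   [(1 - rho^2) * nu^2].  So the mean square error is
   [bias^2 + tau / M + sigma^2 / (M * N)]; bound its square root by the sum of
   the three square roots and apply Minkowski's inequality in [w]. *)

(** * Extension of integral identities from indicators *)

(** The joint law of the samples is known only on measurable rectangles, and no conditional
    distribution is constructed. Every moment is therefore reached by extending an identity from
    indicators to nonnegative functions in one variable at a time, the other variables being frozen
    in a nonnegative weight. Nonnegativity of [S] and of the densities keeps these extensions within
    monotone convergence and Tonelli's theorem; boundedness of [S] makes the resulting moments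
    finite. Particles that share a parameter are independent only conditionally on it. Averaging
    over particles thus leaves [tau] untouched, and only the average over the M parameters reduces
    it. The mean of [f] at a point [w] may be [+oo], so the pointwise bound and Minkowski's
    inequality are needed for extended real functions. *)

Section transfer.
Local Open Scope ereal_scope.
Context {R : realType} {d1 d2 d : measure_display} {T1 : measurableType d1}
  {T2 : measurableType d2} {U : measurableType d}.
Variables (m1 : {measure set T1 -> \bar R}) (m2 : {measure set T2 -> \bar R}).
Variables (X1 : T1 -> U) (X2 : T2 -> U) (h1 : T1 -> \bar R) (h2 : T2 -> \bar R).
Hypotheses (mX1 : measurable_fun setT X1) (mX2 : measurable_fun setT X2).
Hypotheses (mh1 : measurable_fun setT h1) (mh2 : measurable_fun setT h2).
Hypotheses (h10 : forall x, 0 <= h1 x) (h20 : forall x, 0 <= h2 x).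

Import HBNNSimple.

Lemma integral_comp_nnsfun (dT : measure_display) (T : measurableType dT)
    (m : {measure set T -> \bar R}) (X : T -> U) (h : T -> \bar R)
    (g : {nnsfun U >-> R}) :
  measurable_fun setT X -> measurable_fun setT h -> (forall x, 0 <= h x) ->
  \int[m]_x ((g (X x))%:E * h x) =
  \sum_(k \in range g) k%:E * \int[m]_x ((\1_(g @^-1` [set k]) (X x))%:E * h x).
Proof.
move=> mX mh h0.
have mI k : measurable_fun setT
    (fun x : T => (\1_(g @^-1` [set k]) (X x) : R)%:E * h x).
  apply: emeasurable_funM => //; apply/measurable_EFinP.
  by apply: (measurableT_comp (measurable_indic _)).
transitivity (\int[m]_x (\sum_(k \in range g)
    (k%:E * ((\1_(g @^-1` [set k]) (X x))%:E * h x)))).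
  apply: eq_integral => x _.
  rewrite {1}(fimfunE g (X x)) -fsumEFin// ge0_mule_fsuml; last first.
    by move=> k; exact: nnfun_muleindic_ge0.
  by apply: eq_fsbigr => k _; rewrite EFinM muleA.
rewrite ge0_integral_fsum//.
- apply: eq_fsbigr => k; rewrite inE => -[y _ <-].
  by rewrite ge0_integralZl_EFin// => x _; rewrite mule_ge0// lee_fin.
- by move=> k; apply: measurable_funeM.
- move=> k x _; rewrite muleA mule_ge0//.
  exact: nnfun_muleindic_ge0.
Qed.

(** The hypothesis says that the measures with densities [h1] and [h2] have the same image under
    [X1] and [X2]. The weights are what allows repeated use: an identity in several variables is
    extended in one of them while the others sit inside [h1] and [h2]. *)
Lemma eq_integral_comp_indic (phi : U -> \bar R) :
  (forall A, measurable A ->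
    \int[m1]_x ((\1_A (X1 x))%:E * h1 x) =
    \int[m2]_x ((\1_A (X2 x))%:E * h2 x)) ->
  measurable_fun setT phi -> (forall y, 0 <= phi y) ->
  \int[m1]_x (phi (X1 x) * h1 x) = \int[m2]_x (phi (X2 x) * h2 x).
Proof.
move=> h12 mphi phi0.
pose g := nnsfun_approx measurableT mphi.
(* The approximating simple functions live on [U], so one sequence serves both sides. *)
suff lim (dT : measure_display) (T : measurableType dT)
    (m : {measure set T -> \bar R}) (X : T -> U) (h : T -> \bar R) :
    measurable_fun setT X -> measurable_fun setT h -> (forall x, 0 <= h x) ->
    \int[m]_x (phi (X x) * h x) =
    limn (fun n => \int[m]_x ((g n (X x))%:E * h x)).
  rewrite (lim _ _ m1 X1)// (lim _ _ m2 X2)//; congr (limn _).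
  apply/funext => n; rewrite !integral_comp_nnsfun//.
  by apply: eq_fsbigr => k _; congr (_ * _); exact: h12.
move=> mX mh h0; rewrite -monotone_convergence//.
- apply: eq_integral => x _; apply/esym/cvg_lim => //.
  rewrite [X in X @ _ --> _](_ : _ =
    (fun n => (EFin \o (g ^~ (X x))) n * h x))//.
  have /= gphi : (EFin \o (g ^~ (X x))) n @[n --> \oo] --> phi (X x).
    by apply: cvg_nnsfun_approx.
  (* The weight may be [+oo]. Then either [phi (X x) = 0] and every approximation, lying below
     [phi], is 0 as well, or the product tends to [+oo]. *)
  have [hx|] := boolP (h x \is a fin_num); first exact: cvgeZr.
  rewrite fin_numEn => /orP[|] /eqP hx; first by have := h0 x; rewrite hx.
  rewrite hx; have [p0|p0] := eqVneq (phi (X x)) 0.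
    rewrite p0 mul0e; apply: cvg_near_cst; apply: nearW => n /=.
    suff -> : g n (X x) = 0%R by rewrite mul0e.
    apply/eqP; rewrite eq_le; apply/andP; split; last exact: fun_ge0.
    rewrite -lee_fin -[leRHS]p0 nnsfun_approxE; exact: le_approx.
  apply: (@cvgeM _ _ _ _ _ (cst +oo) _ +oo) => //; last exact: cvg_cst.
  by rewrite mule_def_neq0_infty ?p0.
- move=> n; apply: emeasurable_funM => //; apply/measurable_EFinP.
  exact: (measurableT_comp _ mX).
- by move=> n x _; rewrite mule_ge0// lee_fin.
- move=> x _ a b ab; rewrite lee_wpmul2r// lee_fin.
  exact/lefP/nd_nnsfun_approx.
Qed.
End transfer.

(** * Lp norms of extended real functions *)

Section Lnorm_ereal.
Local Open Scope ereal_scope.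
Context {R : realType} {d : measure_display} {T : measurableType d}.
Variable mu : {measure set T -> \bar R}.
Implicit Types f g : T -> \bar R.

(* Neither function has to be measurable: the integral of a nonnegative
   function is a supremum over the simple functions below it. *)
Lemma ge0_le_integral_nomeas f g :
  (forall x, 0 <= f x) -> (forall x, f x <= g x) ->
  \int[mu]_x f x <= \int[mu]_x g x.
Proof.
move=> f0 fg; rewrite !ge0_integralTE//; last first.
  by move=> x; exact: le_trans (fg x).
apply: ereal_sup_le => _ [h hf <-]; exists h => // x.
exact: le_trans (fg x).
Qed.

Lemma le_poweR (r : R) (x y : \bar R) : (0 <= r)%R -> 0 <= x -> x <= y ->
  x `^ r <= y `^ r.
Proof.
move=> r0 x0 xy; apply: gt0_ler_poweR => //; rewrite in_itv/= leey andbT//.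
exact: le_trans xy.
Qed.

Lemma measurable_abse_poweR (r : R) f : measurable_fun setT f ->
  measurable_fun setT (fun x => `|f x| `^ r).
Proof.
move=> mf; apply: (measurableT_comp (measurable_poweR _)).
exact: measurableT_comp.
Qed.

(** It will be applied with [f] the root mean square error, whose measurability in the space
    variable is never established. *)
Lemma le_Lnorm (p : \bar R) f g : 1 <= p -> (forall x, `|f x| <= `|g x|) ->
  Lnorm mu p f <= Lnorm mu p g.
Proof.
case: p => [r| |]//; last 1 first.
- move=> _ fg; rewrite unlock; case: ifPn => // _.
  by apply: le_ess_sup; apply: nearW.
- rewrite lee_fin => r1 fg; have r0 : (0 <= r)%R by exact: le_trans r1.
  rewrite unlock; apply: le_poweR; first by rewrite invr_ge0.
    by apply: integral_ge0 => x _; exact: poweR_ge0.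
  apply: ge0_le_integral_nomeas => x; first exact: poweR_ge0.
  exact: le_poweR.
Qed.

Lemma ge0_LnormZl (p : \bar R) (c : R) f : 1 <= p -> (0 <= c)%R ->
  measurable_fun setT f ->
  Lnorm mu p (fun x => c%:E * f x) = c%:E * Lnorm mu p f.
Proof.
case: p => [r| |]// p1 c0 mf; last first.
  (* For [p = +oo] the norm is an essential supremum, with value 0 by convention when the whole
     space is null. *)
  rewrite unlock; case: ifPn => [mu0|_]; last by rewrite mule0.
  rewrite -ess_supZl//; congr (ess_sup _ _); apply/funext => x /=.
  by rewrite abseM gee0_abs.
have r0 : (0 < r)%R by rewrite -lte_fin; exact: lt_le_trans p1.
rewrite unlock; under eq_integral => x _.
  rewrite abseM gee0_abs// poweRM// poweR_EFin; over.
rewrite ge0_integralZl_EFin ?powR_ge0//; last 2 first.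
- by move=> x _; exact: poweR_ge0.
- exact: measurable_abse_poweR.
rewrite poweRM ?lee_fin ?powR_ge0//; last first.
  by apply: integral_ge0 => x _; exact: poweR_ge0.
by rewrite poweR_EFin -powRrM mulfV ?gt_eqF// powRr1.
Qed.

Lemma Lnorm_lty_ae_fin_num (r : R) f : (1 <= r)%R -> measurable_fun setT f ->
  Lnorm mu r%:E f < +oo -> \forall x \ae mu, f x \is a fin_num.
Proof.
move=> r1 mf Nf; have r0 : (0 < r)%R by exact: lt_le_trans r1.
have : mu.-integrable setT (fun x => `|f x| `^ r).
  apply/integrableP; split.
    exact: measurable_abse_poweR.
  under eq_integral do rewrite gee0_abs ?poweR_ge0//.
  by rewrite -poweR_Lnorm ?gt_eqF// poweR_lty.
move=> /(integrable_ae measurableT); apply: filterS => x /(_ I).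
by case: (f x) => //=; rewrite ?poweRyr ?gt_eqF.
Qed.

(** For finite [p] this reduces to the real-valued inequality: if one norm on the right is infinite
    there is nothing to prove; otherwise both functions are finite almost everywhere, and replacing
    them by their [fine] parts does not change the norms. *)
Lemma ge0_minkowski (p : \bar R) f g : 1 <= p ->
  measurable_fun setT f -> measurable_fun setT g ->
  (forall x, 0 <= f x) -> (forall x, 0 <= g x) ->
  Lnorm mu p (fun x => f x + g x) <= Lnorm mu p f + Lnorm mu p g.
Proof.
case: p => [r| |]// p1 mf mg f0 g0; last first.
  rewrite unlock; case: ifPn => [mu0|_]; last by rewrite adde0.
  exact: ess_sup_absD.
have r1 : (1 <= r)%R by rewrite -lee_fin.
have [->|Nfoo] := eqVneq (Lnorm mu r%:E f) +oo.
  by rewrite addye ?leey// -ltNye (lt_le_trans _ (Lnorm_ge0 _ _ _)).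
have [->|Ngoo] := eqVneq (Lnorm mu r%:E g) +oo.
  by rewrite addey ?leey// -ltNye (lt_le_trans _ (Lnorm_ge0 _ _ _)).
have ff : \forall x \ae mu, f x \is a fin_num.
  by apply: (@Lnorm_lty_ae_fin_num r) => //; rewrite ltey.
have fg : \forall x \ae mu, g x \is a fin_num.
  by apply: (@Lnorm_lty_ae_fin_num r) => //; rewrite ltey.
have mfine h : measurable_fun setT h -> measurable_fun setT
  (fun x : T => fine (h x)).
  by move=> mh; apply: (measurableT_comp (fine_measurable measurableT)).
have aeE (h k : T -> \bar R) : measurable_fun setT h -> measurable_fun setT k ->
    (\forall x \ae mu, h x = k x) -> Lnorm mu r%:E h = Lnorm mu r%:E k.
  move=> mh mk hk; rewrite unlock; congr (_ `^ _).
  apply: ae_eq_integral => //.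
  - exact: measurable_abse_poweR.
  - exact: measurable_abse_poweR.
  - by apply: filterS hk => x -> _.
pose f' x := fine (f x); pose g' x := fine (g x).
rewrite (aeE f (EFin \o f')); last 3 first.
- exact: mf.
- exact/measurable_EFinP/mfine.
- by apply: filterS ff => x fx; rewrite /f' /= fineK.
rewrite (aeE g (EFin \o g')); last 3 first.
- exact: mg.
- exact/measurable_EFinP/mfine.
- by apply: filterS fg => x fx; rewrite /g' /= fineK.
rewrite (aeE _ (EFin \o (f' \+ g')%R)); last 3 first.
- exact: emeasurable_funD.
- by apply/measurable_EFinP; apply: measurable_funD; exact: mfine.
- apply: filterS2 ff fg => x fx gx.
  by rewrite /= EFinD !fineK.
by apply: eminkowski => //; exact: mfine.
Qed.
End Lnorm_ereal.

(** * Bounded random variables *)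

Section bounded_measurable.
Context {R : realType} {d : measure_display} {T : measurableType d}.
Variable P : probability T R.
Implicit Types g h : T -> R.

(** A class closed under sums and products and integrable for every probability, so that the algebra
    of moments below carries no integrability side conditions beyond it. *)
Definition bmeas g := measurable_fun setT g /\ exists B, forall x, `|g x| <= B.

Lemma bmeas_cst (c : R) : bmeas (fun=> c).
Proof. by split; [exact: measurable_cst | exists `|c|]. Qed.

Lemma bmeasD g h : bmeas g -> bmeas h -> bmeas (fun x => g x + h x).
Proof.
move=> [mg [B gB]] [mh [B' hB]]; split; first exact: measurable_funD.
by exists (B + B') => x; rewrite (le_trans (ler_normD _ _))// lerD.
Qed.

Lemma bmeasM g h : bmeas g -> bmeas h -> bmeas (fun x => g x * h x).
Proof.
move=> [mg [B gB]] [mh [B' hB]]; split; first exact: measurable_funM.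
by exists (B * B') => x; rewrite normrM ler_pM.
Qed.

Lemma bmeasZ (c : R) g : bmeas g -> bmeas (fun x => c * g x).
Proof. by apply: bmeasM; exact: bmeas_cst. Qed.

Lemma bmeasB g h : bmeas g -> bmeas h -> bmeas (fun x => g x - h x).
Proof.
move=> bg bh; rewrite (_ : (fun _ => _) = (fun x => g x + (-1) * h x)).
  by apply: bmeasD => //; exact: bmeasZ.
by apply/funext => x; rewrite mulN1r.
Qed.

Lemma bmeas_sum (I : Type) (r : seq I) (F : I -> T -> R) :
  (forall i, bmeas (F i)) -> bmeas (fun x => \sum_(i <- r) F i x).
Proof.
move=> bF; elim: r => [|i r IH].
  by under eq_fun do rewrite big_nil; exact: bmeas_cst.
by under eq_fun do rewrite big_cons; exact: bmeasD.
Qed.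

Lemma bmeas_integrable g : bmeas g -> P.-integrable setT (EFin \o g).
Proof.
move=> [mg [B gB]]; apply: (@le_integrable _ _ _ _ _ _ _ (EFin \o cst B)) => //.
- exact/measurable_EFinP.
- by move=> x _; rewrite /= lee_fin (le_trans (gB x))// ler_norm.
- by apply: finite_measure_integrable_cst.
Qed.

Lemma EFin_Rintegral g : bmeas g ->
  (\int[P]_x g x)%:E = (\int[P]_x (g x)%:E)%E.
Proof. by move=> bg; rewrite fineK//; apply: integrable_fin_num => //;
  exact: bmeas_integrable. Qed.

Lemma bmeas_RintegralD g h : bmeas g -> bmeas h ->
  \int[P]_x (g x + h x) = \int[P]_x g x + \int[P]_x h x.
Proof. by move=> bg bh; rewrite RintegralD//; exact: bmeas_integrable. Qed.

Lemma bmeas_RintegralZ (c : R) g : bmeas g ->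
  \int[P]_x (c * g x) = c * \int[P]_x g x.
Proof. by move=> bg; rewrite RintegralZl//; exact: bmeas_integrable. Qed.

Lemma prob_Rintegral_cst (c : R) : \int[P]_x c = c.
Proof. by rewrite /Rintegral integral_cst//= probability_setT mule1. Qed.

Lemma bmeas_Rintegral_sum (I : Type) (r : seq I) (F : I -> T -> R) :
  (forall i, bmeas (F i)) ->
  \int[P]_x (\sum_(i <- r) F i x) = \sum_(i <- r) \int[P]_x F i x.
Proof.
move=> bF; elim: r => [|i r IH].
  by rewrite big_nil; under eq_Rintegral do rewrite big_nil;
    rewrite prob_Rintegral_cst.
rewrite big_cons -IH -bmeas_RintegralD//; last exact: bmeas_sum.
by apply: eq_Rintegral => x _; rewrite big_cons.
Qed.

Lemma Rintegral_bilinear_expand (p q p' q' : T -> R) (l c : R) :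
  bmeas p -> bmeas q -> bmeas p' -> bmeas q' ->
  \int[P]_x ((p x - l * q x - c) * (p' x - l * q' x - c)) =
  \int[P]_x (p x * p' x) - l * \int[P]_x (p x * q' x)
  - l * \int[P]_x (q x * p' x) + l ^+ 2 * \int[P]_x (q x * q' x)
  - c * (\int[P]_x p x + \int[P]_x p' x)
  + c * l * (\int[P]_x q x + \int[P]_x q' x) + c ^+ 2.
Proof.
move=> bp bq bp' bq'.
have -> : \int[P]_x ((p x - l * q x - c) * (p' x - l * q' x - c)) =
  \int[P]_x (p x * p' x + (- l * (p x * q' x) + (- l * (q x * p' x)
   + (l ^+ 2 * (q x * q' x) + (- c * p x + (- c * p' x
   + (c * l * q x + (c * l * q' x + c ^+ 2)))))))).
  by apply: eq_Rintegral => x _; ring.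
have bc := bmeas_cst (c ^+ 2).
have [b1 b2 b3 b4] : [/\ bmeas (fun x => p x * p' x),
  bmeas (fun x => p x * q' x),
  bmeas (fun x => q x * p' x) & bmeas (fun x => q x * q' x)].
  by split; exact: bmeasM.
rewrite !bmeas_RintegralD ?prob_Rintegral_cst ?bmeas_RintegralZ//;
  do ?[exact: bc | exact: bmeasZ | apply: bmeasD]; ring.
Qed.

Lemma sum_eq_mulr (n : nat) (i : 'I_n) (c : R) :
  \sum_(j < n) (i == j)%:R * c = c.
Proof.
rewrite (bigD1 i)//= eqxx mul1r big1 ?addr0// => j ji.
by rewrite eq_sym (negbTE ji) mul0r.
Qed.

Lemma sum_ord_cst (n : nat) (c : R) : \sum_(i < n) c = n%:R * c.
Proof. by rewrite sumr_const card_ord mulr_natl. Qed.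

(** The cross term with [a] vanishes because the [G k i] are centred. In the square of the double
    sum only pairs from the same block survive, and each of the M blocks contributes
    [N ^ 2 * tau + N * s]; division by [(M * N) ^ 2] gives the two rates. *)
Lemma second_moment_nested_mean (M N : nat) (G : 'I_M -> 'I_N -> T -> R)
    (a tau s : R) : (0 < M)%N -> (0 < N)%N ->
  (forall k i, bmeas (G k i)) -> (forall k i, \int[P]_x G k i x = 0) ->
  (forall k i l j, \int[P]_x (G k i x * G l j x) =
     (k == l)%:R * (tau + (i == j)%:R * s)) ->
  \int[P]_x ((a - (M%:R * N%:R)^-1 * \sum_(k < M) \sum_(i < N) G k i x) ^+ 2)
  = a ^+ 2 + tau / M%:R + s / (M%:R * N%:R).
Proof.
move=> M0 N0 bG G0 GG; set c := (_ * _)^-1.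
pose H x := \sum_(k < M) \sum_(i < N) G k i x.
have bH : bmeas H by do 2 apply: bmeas_sum => ?.
have -> : \int[P]_x ((a - c * H x) ^+ 2) =
    \int[P]_x (a ^+ 2 + (- (2 * a * c) * H x + c ^+ 2 * (H x * H x))).
  by apply: eq_Rintegral => x _; ring.
rewrite !bmeas_RintegralD ?prob_Rintegral_cst ?bmeas_RintegralZ//;
  do ?[exact: bmeas_cst | exact: bmeasM | exact/bmeasZ/bmeasM | exact: bmeasZ
      | apply: bmeasD].
have -> : \int[P]_x H x = 0.
  rewrite bmeas_Rintegral_sum => [|k]; last exact: bmeas_sum.
  rewrite big1// => k _; rewrite bmeas_Rintegral_sum//.
  by rewrite big1.
have -> : \int[P]_x (H x * H x) = M%:R * (N%:R * (N%:R * tau + s)).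
  have -> : \int[P]_x (H x * H x) = \int[P]_x (\sum_(k < M) \sum_(i < N)
      \sum_(l < M) \sum_(j < N) G k i x * G l j x).
    apply: eq_Rintegral => x _; rewrite /H mulr_suml; apply: eq_bigr => k _.
    rewrite mulr_suml; apply: eq_bigr => i _.
    by rewrite mulr_sumr; apply: eq_bigr => l _; rewrite mulr_sumr.
  rewrite bmeas_Rintegral_sum => [|k];
    last by do 3 apply: bmeas_sum => ?; exact: bmeasM.
  rewrite (eq_bigr (fun=> N%:R * (N%:R * tau + s))) => [|k _].
    by rewrite sum_ord_cst.
  rewrite bmeas_Rintegral_sum => [|i];
    last by do 2 apply: bmeas_sum => ?; exact: bmeasM.
  rewrite (eq_bigr (fun=> N%:R * tau + s)) => [|i _].
    by rewrite sum_ord_cst.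
  rewrite bmeas_Rintegral_sum => [|l];
    last by apply: bmeas_sum => ?; exact: bmeasM.
  rewrite -[RHS](@sum_eq_mulr M k); apply: eq_bigr => l _.
  rewrite bmeas_Rintegral_sum => [|j]; last exact: bmeasM.
  under eq_bigr do rewrite GG; rewrite -mulr_sumr big_split/= sum_eq_mulr.
  by rewrite sum_ord_cst.
rewrite /c; field.
by rewrite !pnatr_eq0 -!lt0n M0 N0.
Qed.

End bounded_measurable.

(** * Integration against the conditional law *)

Lemma measurable_fun_comp2 (d d1 d2 d3 : measure_display)
    (T : measurableType d) (T1 : measurableType d1) (T2 : measurableType d2)
    (T3 : measurableType d3) (F : T1 -> T2 -> T3) (g : T -> T1) (h : T -> T2) :
  measurable_fun setT (fun x : T1 * T2 => F x.1 x.2) ->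
  measurable_fun setT g -> measurable_fun setT h ->
  measurable_fun setT (fun x => F (g x) (h x)).
Proof.
move=> mF mg mh.
exact: (measurableT_comp mF (measurable_fun_pair mg mh)).
Qed.

Section kappa.
Local Open Scope ereal_scope.
Context {R : realType} {d : measure_display} {Omega : measurableType d}.
Variables (P : probability Omega R) (V : set R) (f : R -> Omega -> R).
Local Notation leb := (@lebesgue_measure R).
Hypotheses (mV : measurable V)
  (mf : measurable_fun setT (fun x : R * Omega => f x.1 x.2)).
Hypothesis fd : forall z, is_density_on V (fun v => f v z).

(** The conditional expectation of [phi (W k i)] given [Z k = z]. For [phi v = S (w - v)] its [fine]
    part is [smooth S V f w z]. *)
Definition kappa (phi : R -> R) (z : Omega) : \bar R :=
  \int[leb]_(v in V) (phi v * f v z)%:E.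

Let f0 v z : (0 <= f v z)%R. Proof. by have [_ + _] := fd z; exact. Qed.

(** The density of a pair (parameter, particle) with respect to [P \x leb], extended by 0 outside
    [V] so that Tonelli's theorem applies on the full product. *)
Let fV (x : Omega * R) : R := (\1_V x.2 * f x.2 x.1)%R.

Let fV0 x : (0 <= fV x)%R. Proof. by rewrite mulr_ge0// indicE. Qed.

Let mfV : measurable_fun setT fV.
Proof.
apply: measurable_funM.
  exact: (measurableT_comp (measurable_indic mV) measurable_snd).
exact: measurable_fun_comp2 mf measurable_snd measurable_fst.
Qed.

Lemma kappaE (phi : R -> R) z :
  kappa phi z = \int[leb]_v ((phi v)%:E * (fV (z, v))%:E).
Proof.
rewrite /kappa integral_mkcond; apply: eq_integral => v _.
rewrite /fV /= patchE indicE; case: ifPn => _.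
  by rewrite mul1r EFinM.
by rewrite mul0r mule0.
Qed.

Lemma kappa_ge0 (phi : R -> R) z : (forall v, 0 <= phi v)%R -> 0 <= kappa phi z.
Proof. by move=> p0; apply: integral_ge0 => v _; rewrite lee_fin mulr_ge0. Qed.

Lemma kappa1 z : kappa (cst 1%R) z = 1.
Proof. by rewrite /kappa; under eq_integral do rewrite mul1r;
  have [_ _] := fd z. Qed.

Lemma measurable_kappa (phi : R -> R) : measurable_fun setT phi ->
  (forall v, 0 <= phi v)%R -> measurable_fun setT (kappa phi).
Proof.
move=> mphi phi0.
rewrite (_ : kappa phi = fubini_F leb (fun x => (phi x.2)%:E * (fV x)%:E)).
  apply: measurable_fun_fubini_tonelli_F => //.
    apply: emeasurable_funM; apply/measurable_EFinP => //.
    exact: (measurableT_comp mphi measurable_snd).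
  by move=> x; rewrite mule_ge0// lee_fin.
by apply/funext => z; rewrite kappaE.
Qed.

(* The functional [phi |-> \int[P]_z b z * kappa phi z] is an integral over
   the product space, so it is determined by its values on indicators. *)
Lemma eq_integral_kappa (dS : measure_display) (Sigma : measurableType dS)
    (Q : {measure set Sigma -> \bar R}) (U : Sigma -> R) (h : Sigma -> \bar R)
    (b : Omega -> \bar R) (phi : R -> R) :
  measurable_fun setT U -> measurable_fun setT h -> (forall s, 0 <= h s) ->
  measurable_fun setT b -> (forall z, 0 <= b z) ->
  (forall B : set R, measurable B ->
    \int[Q]_s ((\1_B (U s))%:E * h s) = \int[P]_z (b z * kappa \1_B z)) ->
  measurable_fun setT phi -> (forall v, 0 <= phi v)%R ->
  \int[Q]_s ((phi (U s))%:E * h s) = \int[P]_z (b z * kappa phi z).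
Proof.
move=> mU mh h0 mb b0 hB mphi phi0.
have mg : measurable_fun setT (fun x : Omega * R => b x.1 * (fV x)%:E).
  apply: emeasurable_funM; first exact: (measurableT_comp mb measurable_fst).
  exact/measurable_EFinP.
have g0 (x : Omega * R) : 0 <= b x.1 * (fV x)%:E by rewrite mule_ge0// lee_fin.
have prodE (psi : R -> R) : measurable_fun setT psi ->
  (forall v, 0 <= psi v)%R ->
    \int[P]_z (b z * kappa psi z) =
    \int[P \x leb]_x ((psi x.2)%:E * (b x.1 * (fV x)%:E)).
  move=> mpsi psi0.
  rewrite fubini_tonelli1//=; last 2 first.
  - apply: emeasurable_funM => //; apply/measurable_EFinP.
    exact: (measurableT_comp mpsi measurable_snd).
  - by move=> x; rewrite mule_ge0// lee_fin.
  apply: eq_integral => z _; rewrite /fubini_F kappaE/=.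
  under [RHS]eq_integral do rewrite muleCA.
  rewrite ge0_integralZl//.
  - apply: emeasurable_funM; apply/measurable_EFinP => //.
    exact: (measurableT_comp mfV (pair1_measurable _)).
  - by move=> v _; rewrite mule_ge0// lee_fin.
rewrite prodE//.
apply: (@eq_integral_comp_indic _ _ _ _ _ _ _ Q (P \x leb)%E U snd h
  (fun x => b x.1 * (fV x)%:E) mU measurable_snd mh mg h0 g0 (EFin \o phi)).
- by move=> B mB; rewrite hB// prodE//; exact: measurable_indic.
- exact/measurable_EFinP.
- by move=> v; rewrite lee_fin.
Qed.

End kappa.

(** * Moments of the samples *)

(** Two transfers: first the indicator in [X] becomes [phi] with weight [\1_B (Y s)], then the
    indicator in [Y] becomes [psi] with weight [phi (X s)]. On the other side of each identity the
    weight is a constant. *)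
Lemma integral_prod_indep (R : realType) (d d1 d2 : measure_display)
    (T : measurableType d) (T1 : measurableType d1) (T2 : measurableType d2)
    (Q : probability T R) (X : T -> T1) (Y : T -> T2)
    (phi : T1 -> R) (psi : T2 -> R) :
  measurable_fun setT X -> measurable_fun setT Y ->
  (forall A B, measurable A -> measurable B ->
    Q (X @^-1` A `&` Y @^-1` B) = Q (X @^-1` A) * Q (Y @^-1` B))%E ->
  measurable_fun setT phi -> measurable_fun setT psi ->
  (forall x, 0 <= phi x) -> (forall x, 0 <= psi x) ->
  (\int[Q]_s ((phi (X s))%:E * (psi (Y s))%:E) =
   \int[Q]_s (phi (X s))%:E * \int[Q]_s (psi (Y s))%:E)%E.
Proof.
move=> mX mY XY mphi mpsi phi0 psi0.
have mpre (d' : measure_display) (T' : measurableType d') (F : T -> T') A :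
    measurable_fun setT F -> measurable A -> measurable (F @^-1` A).
  by move=> mF mA; rewrite -[X in measurable X]setTI; exact: mF.
have mcomp (d' : measure_display) (T' : measurableType d') (F : T -> T')
    (g : T' -> R) : measurable_fun setT F -> measurable_fun setT g ->
    measurable_fun setT (fun s => (g (F s))%:E).
  by move=> mF mg; apply/measurable_EFinP; exact: measurableT_comp mF.
have step1 B : measurable B ->
    (\int[Q]_s ((phi (X s))%:E * (\1_B (Y s))%:E) =
     \int[Q]_s ((phi (X s))%:E * Q (Y @^-1` B)))%E.
  move=> mB; apply: (@eq_integral_comp_indic _ _ _ _ _ _ _ Q Q X X
    (fun s => (\1_B (Y s))%:E) (cst (Q (Y @^-1` B))) _ _ _ _ _ _
    (EFin \o phi)) => //.
  - by apply: (mcomp _ _ _ \1__) => //; exact: measurable_indic.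
  - move=> A mA; rewrite ge0_integralZr//; last first.
      by apply: (mcomp _ _ _ \1__) => //; exact: measurable_indic.
    rewrite (_ : (\int[Q]_x (\1_A (X x))%:E)%E = Q (X @^-1` A)); last first.
      by rewrite -[LHS]/(\int[Q]_x (\1_(X @^-1` A) x)%:E)%E integral_indic//
        ?setIT//; exact: mpre.
    rewrite -XY// -[X in Q X]setIT -integral_indic//; last first.
      by apply: measurableI; exact: mpre.
    by apply: eq_integral => s _; rewrite indicI /= EFinM.
  - exact/measurable_EFinP.
under eq_integral do rewrite muleC.
rewrite [RHS]muleC -[RHS]ge0_integralZr//; last 3 first.
- exact: (mcomp _ _ Y psi).
- by move=> s _; rewrite lee_fin.
- by apply: integral_ge0 => s _; rewrite lee_fin.
apply: (@eq_integral_comp_indic _ _ _ _ _ _ _ Q Q Y Y (fun s => (phi (X s))%:E)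
  (cst (\int[Q]_s (phi (X s))%:E)%E) _ _ _ _ _ _ (EFin \o psi)) => //.
- exact: (mcomp _ _ X phi).
- by move=> s; rewrite lee_fin.
- by move=> s; apply: integral_ge0 => ? _; rewrite lee_fin.
- move=> B mB; under eq_integral do rewrite muleC; rewrite step1//.
  rewrite ge0_integralZr//; last 2 first.
  + exact: (mcomp _ _ X phi).
  + by move=> s _; rewrite lee_fin.
  rewrite ge0_integralZr//; last 2 first.
  + by apply: (mcomp _ _ _ \1__) => //; exact: measurable_indic.
  + by apply: integral_ge0 => ? _; rewrite lee_fin.
  rewrite muleC; congr (_ * _)%E.
  by rewrite -[RHS]/(\int[Q]_x (\1_(Y @^-1` B) x)%:E)%E integral_indic//
    ?setIT//; exact: mpre.
- exact/measurable_EFinP.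
Qed.

Section sampling.
Local Open Scope ereal_scope.
Context {R : realType} {d dS : measure_display} {Omega : measurableType d}
  {Sigma : measurableType dS}.
Variables (P : probability Omega R) (Q : probability Sigma R) (V : set R)
  (f : R -> Omega -> R) (M N : nat)
  (Z : 'I_M -> Sigma -> Omega) (W : 'I_M -> 'I_N -> Sigma -> R).
Local Notation leb := (@lebesgue_measure R).
Hypotheses (mV : measurable V)
  (mf : measurable_fun setT (fun x : R * Omega => f x.1 x.2)).
Hypothesis fd : forall z, is_density_on V (fun v => f v z).
Hypothesis QZW : is_sampling Q P V f Z W.

Let mZ k : measurable_fun setT (Z k). Proof. by have [+ _ _] := QZW; exact. Qed.
Let mW k i : measurable_fun setT (W k i).
Proof. by have [_ + _] := QZW; exact. Qed.

Let block k (A : set Omega) (B : 'I_N -> set R) : set Sigma :=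
  Z k @^-1` A `&` \bigcap_(i in [set: 'I_N]) (W k i @^-1` B i).
Let mass (A : set Omega) (B : 'I_N -> set R) : \bar R :=
  \int[P]_(z in A) \prod_(i < N) \int[leb]_(v in B i `&` V) (f v z)%:E.

Let massT : mass setT (fun=> setT) = 1.
Proof.
rewrite /mass (eq_integral (cst 1));
  first by rewrite integral_cst//= probability_setT mule1.
by move=> z _; rewrite big1// => i _; rewrite setTI; have [_ _] := fd z.
Qed.

(** The marginal law of one block: leave all other blocks unconstrained, so that each of their
    factors is 1 by [massT]. *)
Lemma sampling_block k A B : measurable A -> (forall i, measurable (B i)) ->
  Q (block k A B) = mass A B.
Proof.
move=> mA mB; have [_ _ law] := QZW.
pose A' l := if l == k then A else setT.
pose B' l := if l == k then B else fun=> setT.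
have := law A' B'; rewrite (bigD1 k)//= [X in _ * X]big1; last first.
  by move=> l lk; rewrite -[RHS]massT /A' /B' (negbTE lk).
rewrite mule1 [X in _ -> _ -> _ = X](_ : _ = mass A B);
  last by rewrite /A' /B' eqxx.
move=> <-.
- congr (Q _); apply/seteqP; split => s.
  + by move=> Hs l _; have [->|lk] := eqVneq l k;
    rewrite /A' /B' ?eqxx ?(negbTE lk).
  + by move=> /(_ k I); rewrite /A' /B' eqxx.
- by move=> l; rewrite /A'; case: ifPn.
- by move=> l i; rewrite /B'; case: ifPn.
Qed.

Lemma sampling_two_blocks k l A B A' B' : k != l ->
  measurable A -> (forall i, measurable (B i)) ->
  measurable A' -> (forall i, measurable (B' i)) ->
  Q (block k A B `&` block l A' B') = Q (block k A B) * Q (block l A' B').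
Proof.
move=> kl mA mB mA' mB'; have [_ _ law] := QZW.
have lk : (l == k) = false by rewrite eq_sym (negbTE kl).
pose a m := if m == k then A else if m == l then A' else setT.
pose b m := if m == k then B else if m == l then B' else fun=> setT.
rewrite !sampling_block//.
have := law a b; rewrite (bigD1 k)//= (bigD1 l)/=; last by rewrite eq_sym.
rewrite [X in _ * (_ * X)]big1; last first.
  by move=> m /andP[mk ml]; rewrite -[RHS]massT /a /b (negbTE mk) (negbTE ml).
rewrite mule1 [X in _ -> _ -> _ = X](_ : _ = mass A B * mass A' B'); last first.
  by rewrite /a /b eqxx lk eqxx.
move=> <-.
- congr (Q _); apply/seteqP; split => s.
  + move=> [Hs Hs'] m _; rewrite /a /b.
    by have [->|mk] := eqVneq m k => //; have [->|ml] := eqVneq m l.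
  + move=> Hs; split.
      by have := Hs k I; rewrite /a /b eqxx.
    by have := Hs l I; rewrite /a /b lk eqxx.
- by move=> m; rewrite /a; case: ifPn => //; case: ifPn.
- by move=> m i; rewrite /b; case: ifPn => //; case: ifPn.
Qed.

Let one (i : 'I_N) (B : set R) (j : 'I_N) := if j == i then B else setT.

Let mone i B j : measurable B -> measurable (one i B j).
Proof. by rewrite /one; case: ifPn. Qed.

Let block_one k i A B : block k A (one i B) = Z k @^-1` A `&` W k i @^-1` B.
Proof.
apply/seteqP; split => s [zA Hs]; split => //.
  by have := Hs i I; rewrite /one eqxx.
by move=> j _; rewrite /one; case: ifPn => // /eqP ->.
Qed.

Let kappa_indic (B : set R) z : measurable B ->
  \int[leb]_(v in B `&` V) (f v z)%:E = kappa V f \1_B z.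
Proof.
move=> mB; rewrite /kappa integral_mkcondl; apply: eq_integral => v _.
by rewrite patchE indicE; case: ifPn; rewrite ?mul1r ?mul0r.
Qed.

Let integral_indic_prod (A B : set Sigma) : measurable A -> measurable B ->
  \int[Q]_s ((\1_A s)%:E * (\1_B s)%:E) = Q (A `&` B).
Proof.
move=> mA mB; rewrite -[X in Q X]setIT -integral_indic//;
  last exact: measurableI.
by apply: eq_integral => s _; rewrite indicI /= EFinM.
Qed.

Let mZpre k A : measurable A -> measurable (Z k @^-1` A).
Proof. by move=> mA; rewrite -[X in measurable X]setTI; exact: mZ. Qed.
Let mWpre k i B : measurable B -> measurable (W k i @^-1` B).
Proof. by move=> mB; rewrite -[X in measurable X]setTI; exact: mW. Qed.

Let kind0 B z : 0 <= kappa V f \1_B z.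
Proof. by apply: kappa_ge0. Qed.
Let mkind B : measurable B -> measurable_fun setT (kappa V f \1_B).
Proof. by move=> mB; apply: measurable_kappa => //;
  exact: measurable_indic. Qed.

(** The law of [(Z k, W k i)] in disintegrated form. The particle variable is extended first, with
    weight [a (Z k s)]; the parameter is then extended with an indicator of the particle as
    weight. *)
Lemma integral_sampling_ZW k i (a : Omega -> R) (psi : R -> R) :
  measurable_fun setT a -> (forall z, 0 <= a z)%R ->
  measurable_fun setT psi -> (forall v, 0 <= psi v)%R ->
  \int[Q]_s ((psi (W k i s))%:E * (a (Z k s))%:E) =
  \int[P]_z ((a z)%:E * kappa V f psi z).
Proof.
move=> ma a0 mpsi psi0.
apply: (@eq_integral_kappa _ _ _ P V f mV mf fd _ _ Q (W k i)
  (fun s => (a (Z k s))%:E) (EFin \o a)) => //.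
- by apply/measurable_EFinP; exact: measurableT_comp (mZ k).
- by move=> s; rewrite lee_fin.
- exact/measurable_EFinP.
move=> B mB; under eq_integral do rewrite muleC.
apply: (@eq_integral_comp_indic _ _ _ _ _ _ _ Q P (Z k) idfun
  (fun s => (\1_B (W k i s))%:E) (kappa V f \1_B) _ _ _ _ _ _
    (EFin \o a)) => //.
- exact: measurable_id.
- by apply/measurable_EFinP;
  exact: measurableT_comp (measurable_indic mB) (mW k i).
- exact: mkind.
- move=> A mA.
  rewrite -[LHS]/(\int[Q]_x ((\1_(Z k @^-1` A) x)%:E *
    (\1_(W k i @^-1` B) x)%:E)).
  rewrite integral_indic_prod; [|exact: mZpre|exact: mWpre].
  rewrite -block_one sampling_block// => [|j]; last exact: mone.
  rewrite /mass [LHS]integral_mkcond; apply: eq_integral => z _.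
  rewrite patchE indicE; case: ifPn => _; last by rewrite mul0e.
  rewrite mul1e (bigD1 i)//= big1 => [|j ji].
    by rewrite mule1 /one eqxx kappa_indic.
  by rewrite /one (negbTE ji) setTI; have [_ _] := fd z.
- exact/measurable_EFinP.
Qed.

(** Conditional independence within a block: the product of the two conditional expectations stays
    under the integral over the common parameter. *)
Lemma integral_sampling_WW k i j (phi psi : R -> R) : i != j ->
  measurable_fun setT phi -> (forall v, 0 <= phi v)%R ->
  measurable_fun setT psi -> (forall v, 0 <= psi v)%R ->
  \int[Q]_s ((psi (W k i s))%:E * (phi (W k j s))%:E) =
  \int[P]_z (kappa V f phi z * kappa V f psi z).
Proof.
move=> ij mphi phi0 mpsi psi0.
apply: (@eq_integral_kappa _ _ _ P V f mV mf fd _ _ Q (W k i)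
  (fun s => (phi (W k j s))%:E) (kappa V f phi)) => //.
- by apply/measurable_EFinP; exact: measurableT_comp (mW k j).
- by move=> s; rewrite lee_fin.
- exact: measurable_kappa.
- by move=> s; exact: kappa_ge0.
move=> B mB; under eq_integral do rewrite muleC.
under [RHS]eq_integral do rewrite muleC.
apply: (@eq_integral_kappa _ _ _ P V f mV mf fd _ _ Q (W k j)
  (fun s => (\1_B (W k i s))%:E) (kappa V f \1_B)) => //.
- by apply/measurable_EFinP;
  exact: measurableT_comp (measurable_indic mB) (mW k i).
- exact: mkind.
move=> B' mB'.
rewrite -[LHS]/(\int[Q]_x ((\1_(W k j @^-1` B') x)%:E *
  (\1_(W k i @^-1` B) x)%:E)).
rewrite integral_indic_prod; [|exact: mWpre|exact: mWpre].
pose BB m := if m == j then B' else if m == i then B else setT.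
rewrite (_ : _ `&` _ = block k setT BB); last first.
  apply/seteqP; split => s.
    move=> [Hj Hi]; split=> // m _; rewrite /BB.
    by have [->|mj] := eqVneq m j => //; have [->|mi] := eqVneq m i.
  move=> [_ Hs]; split; first by have := Hs j I; rewrite /BB eqxx.
  by have := Hs i I; rewrite /BB (negbTE ij) eqxx.
rewrite sampling_block// => [|m]; last first.
  by rewrite /BB; case: ifPn => //; case: ifPn.
rewrite /mass; apply: eq_integral => z _.
rewrite (bigD1 i)//= (bigD1 j)/=; last by rewrite eq_sym.
rewrite big1 => [|m /andP[mi mj]].
  by rewrite mule1 /BB eqxx (negbTE ij) eqxx !kappa_indic.
by rewrite /BB (negbTE mi) (negbTE mj) setTI; have [_ _] := fd z.
Qed.

(** [X] stands for [Z k] or some [W k i], and [Y] likewise for block [l]. Asking only that their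
    preimages be rectangles of the block covers all four combinations at once. *)
Lemma sampling_indep k l (d1 d2 : measure_display) (T1 : measurableType d1)
    (T2 : measurableType d2) (X : Sigma -> T1) (Y : Sigma -> T2)
    (phi : T1 -> R) (psi : T2 -> R) : k != l ->
  (forall A, measurable A -> exists A' i B', [/\ measurable A', measurable B' &
     X @^-1` A = Z k @^-1` A' `&` W k i @^-1` B']) ->
  (forall A, measurable A -> exists A' i B', [/\ measurable A', measurable B' &
     Y @^-1` A = Z l @^-1` A' `&` W l i @^-1` B']) ->
  measurable_fun setT X -> measurable_fun setT Y ->
  measurable_fun setT phi -> measurable_fun setT psi ->
  (forall x, 0 <= phi x)%R -> (forall x, 0 <= psi x)%R ->
  \int[Q]_s ((phi (X s))%:E * (psi (Y s))%:E) =
   \int[Q]_s (phi (X s))%:E * \int[Q]_s (psi (Y s))%:E.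
Proof.
move=> kl Xr Yr mX mY mphi mpsi phi0 psi0; apply: integral_prod_indep => //.
move=> A B /Xr[A' [i [B' [mA' mB' ->]]]] /Yr[A'' [j [B'' [mA'' mB'' ->]]]].
rewrite -!block_one; apply: sampling_two_blocks => // m; exact: mone.
Qed.

End sampling.

(** * The mean square error at a point *)

Section smoothing.
Context {R : realType} {d : measure_display} {Omega : measurableType d}.
Variables (V : set R) (f : R -> Omega -> R).
Local Notation leb := (@lebesgue_measure R).
Hypotheses (mV : measurable V)
  (mf : measurable_fun setT (fun x : R * Omega => f x.1 x.2)).
Hypothesis fd : forall z, is_density_on V (fun v => f v z).

(* [lebesgue_measure] lives on [measurableTypeR R], whose display differs from
   the default one of [R]. *)
Let mVR : measurable (V : set (measurableTypeR R)). Proof. exact: mV. Qed.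

Let f0 v z : 0 <= f v z. Proof. by have [_ + _] := fd z; exact. Qed.

Lemma integrable_density (phi : R -> R) z : bmeas phi ->
  leb.-integrable V (fun v => (phi v * f v z)%:E).
Proof.
move=> [mphi [B phiB]]; have [mfz _ fz1] := fd z.
have If : leb.-integrable V (fun v => (f v z)%:E).
  apply/integrableP; split.
    by apply/measurable_EFinP; exact: measurable_funTS.
  under eq_integral do rewrite gee0_abs ?lee_fin//.
  by rewrite fz1 ltry.
apply: le_integrable (integrableZl mVR B If) => //.
- by apply/measurable_EFinP; apply: measurable_funTS; exact: measurable_funM.
- move=> v _; rewrite !abse_EFin lee_fin/= !normrM ler_wpM2r//.
  exact: le_trans (phiB v) (ler_norm _).
Qed.

Lemma kappa_fin_num (phi : R -> R) z : bmeas phi ->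
  kappa V f phi z \is a fin_num.
Proof. by move=> bphi; apply: integrable_fin_num => //;
  exact: integrable_density. Qed.

Lemma bmeas_fine_kappa (phi : R -> R) : bmeas phi -> (forall v, 0 <= phi v) ->
  bmeas (fun z => fine (kappa V f phi z)).
Proof.
move=> bphi phi0; have [mphi [B phiB]] := bphi; split.
  by apply: (measurableT_comp (fine_measurable measurableT));
    exact: measurable_kappa.
exists B => z; rewrite ger0_norm; last by apply: fine_ge0; exact: kappa_ge0.
rewrite -lee_fin fineK ?kappa_fin_num//.
have [mfz _ fz1] := fd z.
have -> : (B%:E = \int[leb]_(v in V) (B%:E * (f v z)%:E))%E.
  rewrite integralZl//; first by rewrite fz1 mule1.
  have := @integrable_density (cst 1) z (bmeas_cst _).
  by apply: eq_integrable => // v _; rewrite mul1r.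
apply: le_integral => //.
- exact: integrable_density.
- apply: eq_integrable (@integrable_density (cst B) z (bmeas_cst _)) => //.
- move=> v _; rewrite -EFinM lee_fin ler_wpM2r//.
  exact: le_trans (ler_norm _) (phiB v).
Qed.

Lemma kappa_sqr_dev (phi : R -> R) (c : R) z : bmeas phi ->
  fine (kappa V f (fun v => (phi v - c) ^+ 2) z) =
  fine (kappa V f (fun v => phi v ^+ 2) z)
  - 2 * c * fine (kappa V f phi z) + c ^+ 2.
Proof.
move=> bphi; have [_ _ fz1] := fd z.
have I1 : leb.-integrable V (EFin \o (fun v => phi v ^+ 2 * f v z)).
  by apply: integrable_density; exact: bmeasM.
have I2 : leb.-integrable V (EFin \o (fun v => - (2 * c) * (phi v * f v z))).
  have := @integrable_density (fun v => - (2 * c) * phi v) z.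
  move=> /(_ (bmeasZ _ bphi)); apply: eq_integrable => // v _ /=.
  by rewrite mulrA.
have I3 : leb.-integrable V (EFin \o (fun v => c ^+ 2 * f v z)).
  by have := @integrable_density (cst (c ^+ 2)) z (bmeas_cst _).
have If : leb.-integrable V (EFin \o (fun v => f v z)).
  have := @integrable_density (cst 1) z (bmeas_cst _).
  by apply: eq_integrable => // v _; rewrite /= mul1r.
have -> : fine (kappa V f (fun v => (phi v - c) ^+ 2) z) =
   \int[leb]_(v in V) (phi v ^+ 2 * f v z +
     (- (2 * c) * (phi v * f v z) + c ^+ 2 * f v z)).
  by apply: eq_Rintegral => v _; ring.
rewrite RintegralD//; last first.
  apply: eq_integrable (integrableD mVR I2 I3) => // v _.
have Ip : leb.-integrable V (EFin \o (fun v => phi v * f v z)).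
  exact: integrable_density.
rewrite RintegralD// RintegralZl// RintegralZl//
  [X in _ + (_ + _ * X)](_ : _ = 1).
  by rewrite mulr1 mulNr addrA.
by rewrite /Rintegral fz1.
Qed.

End smoothing.

Lemma bmeas_comp (R : realType) (d d' : measure_display) (T : measurableType d)
    (T' : measurableType d') (g : T' -> R) (X : T -> T') :
  bmeas g -> measurable_fun setT X -> bmeas (fun s => g (X s)).
Proof.
move=> [mg [B gB]] mX; split; first exact: measurableT_comp mX.
by exists B.
Qed.

Lemma fine_covariance (R : realType) (d : measure_display)
    (T : measurableType d) (P : probability T R) (X Y : T -> R) :
  bmeas X -> bmeas Y -> fine (covariance P X Y) =
  \int[P]_z (X z * Y z) - \int[P]_z X z * \int[P]_z Y z.
Proof.
move=> bX bY.
have L1 g : bmeas g -> g \in Lfun P 1.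
  by move=> bg; apply/Lfun1_integrable; exact: bmeas_integrable.
have E g : bmeas g -> 'E_P[g]%E = (\int[P]_z g z)%:E.
  by move=> bg; rewrite EFin_Rintegral// unlock.
have bXY : bmeas (X * Y) := bmeasM bX bY.
by rewrite covarianceE ?L1// !E.
Qed.

Lemma bmeas_Rintegral_prod (R : realType) (dS d1 d2 : measure_display)
    (Sigma : measurableType dS) (T1 : measurableType d1)
    (T2 : measurableType d2) (Q : probability Sigma R)
    (X : Sigma -> T1) (Y : Sigma -> T2)
    (phi : T1 -> R) (ps : T2 -> R) :
  bmeas (fun s => phi (X s)) -> bmeas (fun s => ps (Y s)) ->
  (\int[Q]_s ((phi (X s))%:E * (ps (Y s))%:E) =
   \int[Q]_s (phi (X s))%:E * \int[Q]_s (ps (Y s))%:E)%E ->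
  \int[Q]_s (phi (X s) * ps (Y s)) = \int[Q]_s phi (X s) * \int[Q]_s ps (Y s).
Proof.
move=> b1 b2 H; rewrite /Rintegral; under eq_integral do rewrite EFinM.
by rewrite H -!EFin_Rintegral.
Qed.

Section moments.
Context {R : realType} {d dS : measure_display} {Omega : measurableType d}
  {Sigma : measurableType dS}.
Variables (P : probability Omega R) (Q : probability Sigma R) (V : set R)
  (f : R -> Omega -> R) (M N : nat)
  (Z : 'I_M -> Sigma -> Omega) (W : 'I_M -> 'I_N -> Sigma -> R).
Hypotheses (mV : measurable V)
  (mf : measurable_fun setT (fun x : R * Omega => f x.1 x.2)).
Hypothesis fd : forall z, is_density_on V (fun v => f v z).
Hypothesis QZW : is_sampling Q P V f Z W.
Variables (psi : R -> R) (x : Omega -> R).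
Hypotheses (bpsi : bmeas psi) (psi0 : forall v, 0 <= psi v).
Hypotheses (bx : bmeas x) (x0 : forall z, 0 <= x z).

Let mZ k : measurable_fun setT (Z k). Proof. by have [+ _ _] := QZW; exact. Qed.
Let mW k i : measurable_fun setT (W k i).
Proof. by have [_ + _] := QZW; exact. Qed.

Lemma Rintegral_sampling_ZW k i (a : Omega -> R) (phi : R -> R) :
  bmeas a -> (forall z, 0 <= a z) -> bmeas phi -> (forall v, 0 <= phi v) ->
  \int[Q]_s (phi (W k i s) * a (Z k s)) =
  \int[P]_z (a z * fine (kappa V f phi z)).
Proof.
move=> [ma _] a0 bphi phi0; congr fine; under eq_integral do rewrite EFinM.
rewrite (integral_sampling_ZW mV mf fd QZW)//; last by case: bphi.
by apply: eq_integral => z _; rewrite EFinM fineK//; exact: kappa_fin_num.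
Qed.

Let y z := fine (kappa V f psi z).
Let bmy : bmeas y. Proof. exact: bmeas_fine_kappa. Qed.

Let EW k i : \int[Q]_s psi (W k i s) = \int[P]_z y z.
Proof.
rewrite -[RHS](@eq_Rintegral _ _ _ P setT _ (fun z => 1 * y z)).
  rewrite -(@Rintegral_sampling_ZW k i (cst 1))//; last exact: bmeas_cst.
  by apply: eq_Rintegral => s _; rewrite mulr1.
by move=> z _; rewrite mul1r.
Qed.

Let EWW k i : \int[Q]_s (psi (W k i s) * psi (W k i s)) =
  \int[P]_z fine (kappa V f (fun v => psi v ^+ 2) z).
Proof.
rewrite -[RHS](@eq_Rintegral _ _ _ P setT _
  (fun z => 1 * fine (kappa V f (fun v => psi v ^+ 2) z))).
  rewrite -(@Rintegral_sampling_ZW k i (cst 1))//.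
  - by apply: eq_Rintegral => s _; rewrite mulr1.
  - exact: bmeas_cst.
  - exact: bmeasM.
  - by move=> v; exact: sqr_ge0.
by move=> z _; rewrite mul1r.
Qed.

Let fine_kappa1 z : fine (kappa V f (fun=> 1) z) = 1.
Proof. by rewrite (kappa1 fd). Qed.

Hypothesis N0 : (0 < N)%N.

(** Read off from the joint law of [Z k] and the first particle of its block, with the constant 1 as
    function of the particle; hence [N0]. *)
Let EZ k (a : Omega -> R) : bmeas a -> (forall z, 0 <= a z) ->
  \int[Q]_s a (Z k s) = \int[P]_z a z.
Proof.
move=> ba a0.
rewrite -[RHS](@eq_Rintegral _ _ _ P setT _
    (fun z => a z * fine (kappa V f (fun=> 1) z))).
  rewrite -(@Rintegral_sampling_ZW k (Ordinal N0))//; last exact: bmeas_cst.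
  by apply: eq_Rintegral => s _; rewrite mul1r.
by move=> z _; rewrite fine_kappa1 mulr1.
Qed.

Let EWZ k i : \int[Q]_s (psi (W k i s) * x (Z k s)) = \int[P]_z (y z * x z).
Proof.
rewrite Rintegral_sampling_ZW//; apply: eq_Rintegral => z _; exact: mulrC.
Qed.

Let EWW' k i j : i != j ->
  \int[Q]_s (psi (W k i s) * psi (W k j s)) = \int[P]_z (y z * y z).
Proof.
move=> ij; congr fine; under eq_integral do rewrite EFinM.
have [mpsi _] := bpsi.
rewrite (integral_sampling_WW mV mf fd QZW)//.
by apply: eq_integral => z _; rewrite EFinM fineK//; exact: kappa_fin_num.
Qed.

Let rectW k i (A : set R) : measurable A -> exists A' i' B',
  [/\ measurable A', measurable B' &
     W k i @^-1` A = Z k @^-1` A' `&` W k i' @^-1` B'].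
Proof.
by move=> mA; exists setT, i, A; split => //; rewrite preimage_setT setTI.
Qed.

Let rectZ k (A : set Omega) : measurable A ->
  exists A' (i' : 'I_N) (B' : set R),
  [/\ measurable A', measurable B' &
     Z k @^-1` A = Z k @^-1` A' `&` W k i' @^-1` B'].
Proof.
by move=> mA; exists A, (Ordinal N0), setT; split => //;
  rewrite preimage_setT setIT.
Qed.

Let mpsi : measurable_fun setT psi. Proof. by case: bpsi. Qed.
Let mx : measurable_fun setT x. Proof. by case: bx. Qed.

Let bW k i : bmeas (fun s => psi (W k i s)). Proof. exact: bmeas_comp. Qed.
Let bZ k : bmeas (fun s => x (Z k s)). Proof. exact: bmeas_comp. Qed.

(** Here [l] is arbitrary, [tau] is the variance of [y - l * x] written out, and [s] is the mean of
    the conditional variance of [psi (W k i)]. Different blocks are independent; two particles of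
    one block see each other only through [y (Z k)]. *)
Lemma sampling_moments (l : R) (Ey := \int[P]_z y z) (Ex := \int[P]_z x z)
    (tau := \int[P]_z (y z * y z) - Ey ^+ 2
      - 2 * l * (\int[P]_z (y z * x z) - Ey * Ex)
      + l ^+ 2 * (\int[P]_z (x z * x z) - Ex ^+ 2))
    (s := \int[P]_z fine (kappa V f (fun v => psi v ^+ 2) z)
          - \int[P]_z (y z * y z))
    (G := fun k i t => psi (W k i t) - l * x (Z k t) - (Ey - l * Ex)) :
  [/\ forall k i, bmeas (G k i), forall k i, \int[Q]_t G k i t = 0 &
    forall k i m j, \int[Q]_t (G k i t * G m j t) =
      (k == m)%:R * (tau + (i == j)%:R * s)].
Proof.
split.
- move=> k i; apply: bmeasB; last exact: bmeas_cst.
  by apply: bmeasB => //; exact: bmeasZ.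
- move=> k i.
  have -> : \int[Q]_t G k i t =
      \int[Q]_t (psi (W k i t) + (- l * x (Z k t) + - (Ey - l * Ex))).
    by apply: eq_Rintegral => t _; rewrite /G; ring.
  rewrite !bmeas_RintegralD ?prob_Rintegral_cst ?bmeas_RintegralZ//;
    do ?[exact: bmeas_cst | exact: bmeasZ | apply: bmeasD].
  by rewrite EW EZ// -/Ey -/Ex; ring.
move=> k i m j; rewrite Rintegral_bilinear_expand// !EW !EZ// -/Ey -/Ex.
have [<-|km] := eqVneq k m; last first.
  rewrite (bmeas_Rintegral_prod (X := W k i) (Y := W m j))//; last first.
    by apply: (sampling_indep fd QZW km) => //; exact: rectW.
  rewrite (bmeas_Rintegral_prod (X := W k i) (Y := Z m))//; last first.
    by apply: (sampling_indep fd QZW km) => //; [exact: rectW|exact: rectZ].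
  rewrite (bmeas_Rintegral_prod (X := Z k) (Y := W m j))//; last first.
    by apply: (sampling_indep fd QZW km) => //; [exact: rectZ|exact: rectW].
  rewrite (bmeas_Rintegral_prod (X := Z k) (Y := Z m))//; last first.
    by apply: (sampling_indep fd QZW km) => //; exact: rectZ.
  by rewrite !EW !EZ// -/Ey -/Ex mul0r; ring.
rewrite EWZ (_ : \int[Q]_t (x (Z k t) * psi (W k j t)) =
  \int[P]_z (y z * x z)); last first.
  by rewrite -(EWZ k j); apply: eq_Rintegral => t _; exact: mulrC.
rewrite (@EZ k (fun z => x z * x z)); [|exact: bmeasM
  |by move=> z; exact: mulr_ge0].
(* On the diagonal the mean of [psi ^ 2] takes the place of the mean of [y ^ 2]; the difference is
   [s]. *)
have [<-|ij] := eqVneq i j; first by rewrite EWW /tau /s !mul1r; ring.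
by rewrite EWW'// /tau mul1r mul0r; ring.
Qed.

End moments.

Section pointwise.
Context {R : realType} {d : measure_display} {Omega : measurableType d}.
Variables (P : probability Omega R) (V : set R) (f ft : R -> Omega -> R)
  (S : R -> R).
Local Notation leb := (@lebesgue_measure R).
Hypotheses (mV : measurable V)
  (mf : measurable_fun setT (fun x : R * Omega => f x.1 x.2))
  (mft : measurable_fun setT (fun x : R * Omega => ft x.1 x.2)).
Hypothesis fd : forall z, is_density_on V (fun v => f v z).
Hypothesis ftd : forall z, is_density_on V (fun v => ft v z).
Hypotheses (bS : bmeas S) (S0 : forall x, 0 <= S x).

Lemma bmeas_kernel (w : R) : bmeas (fun v : R => S (w - v)).
Proof.
by apply: (bmeas_comp bS); apply: measurable_funB => //; exact: measurable_cst.
Qed.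

Lemma bmeas_smooth (g : R -> Omega -> R) w :
  measurable_fun setT (fun x : R * Omega => g x.1 x.2) ->
  (forall z, is_density_on V (fun v => g v z)) -> bmeas (smooth S V g w).
Proof. by move=> mg gd; apply: bmeas_fine_kappa => //; exact: bmeas_kernel. Qed.

Lemma smooth_ge0 (g : R -> Omega -> R) w z :
  (forall z, is_density_on V (fun v => g v z)) -> 0 <= smooth S V g w z.
Proof. by move=> gd; apply: fine_ge0; exact: kappa_ge0. Qed.

Lemma sigma2_SE w z : sigma2_S S V f w z =
  fine (kappa V f (fun v => S (w - v) ^+ 2) z) - smooth S V f w z ^+ 2.
Proof.
rewrite [LHS](kappa_sqr_dev mV fd _ _ (bmeas_kernel w)) /smooth
  -/(kappa V f _ z).
ring.
Qed.

(** Shows that [sigma2_SM] is finite and equals the [s] of [sampling_moments] for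
    [psi v = S (w - v)]. *)
Lemma sigma2_SME w : sigma2_SM P S V f w =
  (\int[P]_z fine (kappa V f (fun v => S (w - v) ^+ 2) z)
   - \int[P]_z (smooth S V f w z * smooth S V f w z))%:E.
Proof.
have b2 : bmeas (fun z => fine (kappa V f (fun v => S (w - v) ^+ 2) z)).
  apply: bmeas_fine_kappa => // [|v]; last exact: sqr_ge0.
  by apply: bmeasM; exact: bmeas_kernel.
have bmy := bmeas_smooth w mf fd.
rewrite /sigma2_SM unlock -RintegralB//; last 2 first.
- exact: bmeas_integrable.
- exact/bmeas_integrable/bmeasM.
rewrite EFin_Rintegral; last by apply: bmeasB => //; exact: bmeasM.
by apply: eq_integral => z _; rewrite sigma2_SE expr2.
Qed.

Lemma sigma2_SM_ge0 w : (0 <= sigma2_SM P S V f w)%E.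
Proof.
apply: expectation_ge0 => z; apply: fine_ge0; apply: integral_ge0 => v _.
by rewrite lee_fin mulr_ge0 ?sqr_ge0//; have [_ + _] := fd z; exact.
Qed.

Context {dS : measure_display} {Sigma : measurableType dS}.
Variables (Q : probability Sigma R) (M N : nat)
  (Z : 'I_M -> Sigma -> Omega) (W : 'I_M -> 'I_N -> Sigma -> R).
Hypothesis QZW : is_sampling Q P V f Z W.
Hypotheses (M0 : (0 < M)%N) (N0 : (0 < N)%N).

(** [e] stands for the mean of [f] at [w] when it is finite. The choice of [l] enters only here:
    [nu2 - 2 * l * cov + l ^ 2 * Var x] is minimal at [lambda_star], where it is
    [nu2 - cov ^ 2 / Var x], that is [(1 - rho ^ 2) * nu2]. *)
Lemma estimator_second_moment w (e : R) :
  (0 < 'V_P[smooth S V ft w])%E -> (0 < 'V_P[smooth S V f w])%E ->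
  (\int[Q]_s ((e - estimator P S V f ft Z W w s) ^+ 2)%:E)%E =
  ((e - \int[P]_z smooth S V f w z) ^+ 2
   + (1 - rho P S V f ft w ^+ 2) * nu2 P S V f w / M%:R
   + fine (sigma2_SM P S V f w) / (M%:R * N%:R))%:E.
Proof.
move=> Vx Vy.
have bpsi := bmeas_kernel w.
have bx : bmeas (smooth S V ft w) by exact: bmeas_smooth.
have bmy : bmeas (smooth S V f w) by exact: bmeas_smooth.
have x0 z := smooth_ge0 w z ftd.
set l := lambda_star P S V f ft w.
pose y := smooth S V f w; pose x := smooth S V ft w.
pose Ey := \int[P]_z y z; pose Ex := \int[P]_z x z.
pose G k i t := S (w - W k i t) - l * x (Z k t) - (Ey - l * Ex).
pose tau := \int[P]_z (y z * y z) - Ey ^+ 2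
  - 2 * l * (\int[P]_z (y z * x z) - Ey * Ex)
  + l ^+ 2 * (\int[P]_z (x z * x z) - Ex ^+ 2).
pose s := \int[P]_z fine (kappa V f (fun v => S (w - v) ^+ 2) z)
  - \int[P]_z (y z * y z).
have [bG EG EGG] : [/\ forall k i, bmeas (G k i),
    forall k i, \int[Q]_t G k i t = 0 &
    forall k i m j, \int[Q]_t (G k i t * G m j t) =
      (k == m)%:R * (tau + (i == j)%:R * s)].
  exact: (sampling_moments mV mf fd QZW bpsi (fun v => S0 _) bx x0 N0 l).
(* The control variate at [Z k] is repeated for each of the N particles, which fits the single sum
   over k into the double sum. *)
have est t : e - estimator P S V f ft Z W w t =
    (e - Ey) - (M%:R * N%:R)^-1 * \sum_(k < M) \sum_(i < N) G k i t.
  have -> : \sum_(k < M) \sum_(i < N) G k i t =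
      \sum_(k < M) \sum_(i < N) S (w - W k i t)
      - N%:R * (l * \sum_(k < M) smooth S V ft w (Z k t))
      - M%:R * (N%:R * (Ey - l * Ex)).
    under eq_bigr do rewrite !sumrB !sum_ord_cst.
    by rewrite !sumrB !sum_ord_cst -!mulr_sumr; ring.
  rewrite /estimator -/l (_ : fine 'E_P[smooth S V ft w] = Ex);
    last by rewrite unlock.
  rewrite /fN -mulr_sumr; field.
  by rewrite !pnatr_eq0 -!lt0n M0 N0.
have bGs : bmeas (fun t => e - estimator P S V f ft Z W w t).
  rewrite (funext est).
  apply: bmeasB; first exact: bmeas_cst.
  by apply: bmeasZ; do 2 apply: bmeas_sum => ?.
rewrite -EFin_Rintegral; last exact: bmeasM.
congr EFin; under eq_Rintegral do rewrite est.
rewrite (second_moment_nested_mean _ M0 N0 bG EG EGG).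
congr (_ + _ / _ + _ / _); last by rewrite sigma2_SME.
have cov := fine_covariance P bmy bx.
have vx := fine_covariance P bx bx.
have vy := fine_covariance P bmy bmy.
(* Positivity passes to the real number [nu2] because the variance is finite; [fine] would send
   [+oo] to 0. *)
have vy0 : 0 < nu2 P S V f w.
  apply: fine_gt0; rewrite Vy/= /variance -ge0_fin_numE ?(ltW Vy)//.
  by apply: covariance_fin_num; apply/Lfun1_integrable/bmeas_integrable => //;
    exact: bmeasM.
have vx0 : 0 < nu2 P S V ft w.
  apply: fine_gt0; rewrite Vx/= /variance -ge0_fin_numE ?(ltW Vx)//.
  by apply: covariance_fin_num; apply/Lfun1_integrable/bmeas_integrable => //;
    exact: bmeasM.
have -> : tau = nu2 P S V f w - 2 * l *
    fine (covariance P (smooth S V f w) (smooth S V ft w))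
    + l ^+ 2 * nu2 P S V ft w.
  by rewrite /tau cov /nu2 /variance vx vy !expr2.
have -> : rho P S V f ft w ^+ 2 =
    fine (covariance P (smooth S V f w) (smooth S V ft w)) ^+ 2
    / (nu2 P S V f w * nu2 P S V ft w).
  by rewrite /rho expr_div_n exprMn !sqr_sqrtr ?ltW.
rewrite /l /lambda_star -/(nu2 P S V ft w).
by field; rewrite !gt_eqF.
Qed.

End pointwise.

(** * Measurability in the space variable *)

Section measurability.
Context {R : realType} {d : measure_display} {Omega : measurableType d}.
Variables (P : probability Omega R) (V : set R).
Local Notation leb := (@lebesgue_measure R).
Hypothesis mV : measurable V.

Lemma measurable_fun_integral_density (dT : measure_display)
    (T : measurableType dT) (F : T -> R -> R) :
  measurable_fun setT (fun x : T * R => F x.1 x.2) ->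
  (forall x v, 0 <= F x v) ->
  measurable_fun setT (fun x => \int[leb]_(v in V) (F x v)%:E)%E.
Proof.
move=> mF F0.
rewrite (_ : (fun _ => _) = fubini_F leb
    (fun x : T * R => (\1_V x.2 * F x.1 x.2)%:E)); last first.
  apply/funext => x; rewrite integral_mkcond; apply: eq_integral => v _.
  by rewrite patchE indicE/=; case: ifPn; rewrite ?mul1r ?mul0r.
apply: measurable_fun_fubini_tonelli_F => [|x].
  apply/measurable_EFinP; apply: measurable_funM => //.
  exact: (measurableT_comp (measurable_indic mV) measurable_snd).
by rewrite lee_fin mulr_ge0.
Qed.

Lemma measurable_fun_integral_prob (dT : measure_display)
    (T : measurableType dT) (F : T -> Omega -> R) :
  measurable_fun setT (fun x : T * Omega => F x.1 x.2) ->
  (forall x z, 0 <= F x z) ->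
  measurable_fun setT (fun x => \int[P]_z (F x z)%:E)%E.
Proof.
move=> mF F0.
apply: (@measurable_fun_fubini_tonelli_F _ _ _ _ _ P
  (fun x : T * Omega => (F x.1 x.2)%:E)) => [|x].
  exact/measurable_EFinP.
by rewrite lee_fin.
Qed.

Lemma measurable_fun_Rintegral_prob (dT : measure_display)
    (T : measurableType dT) (F : T -> Omega -> R) :
  measurable_fun setT (fun x : T * Omega => F x.1 x.2) ->
  (forall x z, 0 <= F x z) ->
  measurable_fun setT (fun x => \int[P]_z F x z).
Proof.
move=> mF F0; apply: (measurableT_comp (fine_measurable measurableT)).
exact: measurable_fun_integral_prob.
Qed.

Lemma measurable_sqrtr : measurable_fun setT (@Num.sqrt R).
Proof. exact: continuous_measurable_fun (@sqrt_continuous R). Qed.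

(** The value 0 must be allowed: measurability is proved on the whole line, while the variances in
    the denominator of [rho] are known to be positive only on [V]. The power with exponent -1 has
    the same value at 0 as the inverse. *)
Lemma measurable_fun_ge0_inv (dT : measure_display) (T : measurableType dT)
    (g : T -> R) : measurable_fun setT g -> (forall x, 0 <= g x) ->
  measurable_fun setT (fun x => (g x)^-1).
Proof.
move=> mg g0; rewrite (_ : (fun _ => _) = (fun x => g x `^ (-1))).
  exact: (measurableT_comp (measurable_powR _) mg).
by apply/funext => x; rewrite powR_inv1.
Qed.

Variables (f ft : R -> Omega -> R) (S : R -> R).
Hypotheses (mf : measurable_fun setT (fun x : R * Omega => f x.1 x.2))
  (mft : measurable_fun setT (fun x : R * Omega => ft x.1 x.2)).
Hypothesis fd : forall z, is_density_on V (fun v => f v z).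
Hypothesis ftd : forall z, is_density_on V (fun v => ft v z).
Hypotheses (bS : bmeas S) (S0 : forall x, 0 <= S x).

Let mS : measurable_fun setT S. Proof. by case: bS. Qed.

(** Used with [p] equal to [S] for the smoothed densities and to its square for the conditional
    second moment. *)
Let measurable_kernel (p : R -> R) (g : R -> Omega -> R) :
  measurable_fun setT p ->
  measurable_fun setT (fun x : R * Omega => g x.1 x.2) ->
  measurable_fun setT
    (fun x : (R * Omega) * R => p (x.1.1 - x.2) * g x.2 x.1.2).
Proof.
move=> mp mg.
have m11 : measurable_fun setT (fun x : (R * Omega) * R => x.1.1).
  exact: (measurableT_comp measurable_fst measurable_fst).
have m12 : measurable_fun setT (fun x : (R * Omega) * R => x.1.2).
  exact: (measurableT_comp measurable_snd measurable_fst).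
apply: measurable_funM; last exact: measurable_fun_comp2 mg measurable_snd m12.
apply: (measurableT_comp mp).
by apply: measurable_funB => //; exact: measurable_snd.
Qed.

Lemma measurable_fun_smooth (g : R -> Omega -> R) :
  measurable_fun setT (fun x : R * Omega => g x.1 x.2) ->
  (forall z, is_density_on V (fun v => g v z)) ->
  measurable_fun setT (fun x : R * Omega => smooth S V g x.1 x.2).
Proof.
move=> mg gd; apply: (measurableT_comp (fine_measurable measurableT)).
apply: (@measurable_fun_integral_density _ _
  (fun (x : R * Omega) v => S (x.1 - v) * g v x.2));
    first exact: measurable_kernel.
by move=> x v; rewrite mulr_ge0//; have [_ + _] := gd x.2; exact.
Qed.

Let msf := measurable_fun_smooth mf fd.
Let sf0 w z : 0 <= smooth S V f w z. Proof. exact: smooth_ge0. Qed.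

Let measurable_cov (g h : R -> Omega -> R) :
  measurable_fun setT (fun x : R * Omega => g x.1 x.2) ->
  measurable_fun setT (fun x : R * Omega => h x.1 x.2) ->
  (forall z, is_density_on V (fun v => g v z)) ->
  (forall z, is_density_on V (fun v => h v z)) ->
  measurable_fun setT
    (fun w => fine (covariance P (smooth S V g w) (smooth S V h w))).
Proof.
move=> mg mh gd hd.
have msg := measurable_fun_smooth mg gd;
  have msh := measurable_fun_smooth mh hd.
(* The covariance integrates a signed function; this form involves only integrals of nonnegative
   ones, to which Tonelli measurability applies. *)
rewrite (_ : (fun _ => _) = (fun w =>
    \int[P]_z (smooth S V g w z * smooth S V h w z)
    - \int[P]_z smooth S V g w z * \int[P]_z smooth S V h w z)); last first.
  by apply/funext => w; rewrite fine_covariance//; exact: bmeas_smooth.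
apply: measurable_funB; last apply: measurable_funM.
- apply: measurable_fun_Rintegral_prob; first exact: measurable_funM.
  by move=> w z; rewrite mulr_ge0// smooth_ge0.
- by apply: measurable_fun_Rintegral_prob => // w z; exact: smooth_ge0.
- by apply: measurable_fun_Rintegral_prob => // w z; exact: smooth_ge0.
Qed.

Lemma measurable_fun_sigma2_SM : measurable_fun setT (sigma2_SM P S V f).
Proof.
rewrite (_ : sigma2_SM P S V f =
  (fun w => \int[P]_z (sigma2_S S V f w z)%:E)%E); last first.
  by apply/funext => w; rewrite /sigma2_SM unlock.
apply: measurable_fun_integral_prob; last first.
  move=> w z; apply: fine_ge0; apply: integral_ge0 => v _.
  by rewrite lee_fin mulr_ge0 ?sqr_ge0//; have [_ + _] := fd z; exact.
rewrite (_ : (fun _ => _) = (fun x : R * Omega =>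
  fine (kappa V f (fun v => S (x.1 - v) ^+ 2) x.2)
  - smooth S V f x.1 x.2 ^+ 2)); last first.
  by apply/funext => x; rewrite (sigma2_SE mV fd).
apply: measurable_funB; last exact: measurable_funX.
apply: (measurableT_comp (fine_measurable measurableT)).
apply: (@measurable_fun_integral_density _ _
  (fun (x : R * Omega) v => S (x.1 - v) ^+ 2 * f v x.2)).
  apply: (@measurable_kernel (fun u => S u ^+ 2)) => //.
  exact: measurable_funX.
by move=> x v; rewrite mulr_ge0 ?sqr_ge0//; have [_ + _] := fd x.2; exact.
Qed.

Lemma measurable_fun_residual : measurable_fun setT (fun w =>
  Num.sqrt (1 - rho P S V f ft w ^+ 2) * Num.sqrt (nu2 P S V f w)).
Proof.
have mnf : measurable_fun setT (fun w => Num.sqrt (nu2 P S V f w)).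
  apply: (measurableT_comp measurable_sqrtr); exact: (measurable_cov mf mf).
have mnft : measurable_fun setT (fun w => Num.sqrt (nu2 P S V ft w)).
  apply: (measurableT_comp measurable_sqrtr); exact: (measurable_cov mft mft).
apply: measurable_funM => //; apply: (measurableT_comp measurable_sqrtr).
apply: measurable_funB; first exact: measurable_cst.
apply: measurable_funX; apply: measurable_funM.
  exact: (measurable_cov mf mft).
apply: measurable_fun_ge0_inv; first exact: measurable_funM.
by move=> w; rewrite mulr_ge0 ?sqrtr_ge0.
Qed.

Lemma measurable_fun_bias : measurable_fun setT
  (fun w => 'E_P[f w] - 'E_P[smooth S V f w])%E.
Proof.
apply: emeasurable_funB; rewrite unlock.
  apply: measurable_fun_integral_prob => // w z.
  by have [_ + _] := fd z; exact.
exact: measurable_fun_integral_prob.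
Qed.

End measurability.

(** * From the mean square error to the norm estimate *)

Lemma sqrtr_error_le (R : realType) (a v1 v2 t s m n : R) :
  1 <= m -> 0 < n -> 0 <= s -> 0 <= v2 -> t = v1 * v2 ->
  Num.sqrt (a ^+ 2 + t / m + s / (m * n)) <=
  (Num.sqrt m)^-1 * (Num.sqrt v1 * Num.sqrt v2)
  + ((Num.sqrt n)^-1 * Num.sqrt s + `|a|).
Proof.
move=> m1 n0 s0 v20 ->; have m0 : 0 < m by exact: lt_le_trans m1.
set A := (Num.sqrt m)^-1 * _; set B := _ * Num.sqrt s.
have A0 : 0 <= A by rewrite !mulr_ge0 ?invr_ge0 ?sqrtr_ge0.
have B0 : 0 <= B by rewrite !mulr_ge0 ?invr_ge0 ?sqrtr_ge0.
have ABa0 : 0 <= A + (B + `|a|) by rewrite !addr_ge0.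
rewrite -[leRHS](ger0_norm ABa0) -sqrtr_sqr ler_wsqrtr//.
have A2 : v1 * v2 / m <= A ^+ 2.
  rewrite exprMn exprVn sqr_sqrtr ?(ltW m0)// exprMn (sqr_sqrtr v20)
    [leRHS]mulrC.
  rewrite ler_wpM2r ?invr_ge0 ?(ltW m0)// ler_wpM2r//.
  (* [v1] will be [1 - rho ^ 2]. If it were negative its [Num.sqrt] would be 0, and
     [v1 <= Num.sqrt v1 ^ 2] would still hold. *)
  have [v10|v10] := leP 0 v1; first by rewrite sqr_sqrtr.
  by rewrite (le_trans (ltW v10))// sqr_ge0.
(* The extra factor [1 / m] of the particle term is given up here, using [1 <= m]. *)
have B2 : s / (m * n) <= B ^+ 2.
  rewrite exprMn exprVn !sqr_sqrtr// ?(ltW n0)// [leRHS]mulrC.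
  by rewrite ler_wpM2l// invfM ler_piMl ?invr_ge0 ?(ltW n0)// invf_le1.
have -> : (A + (B + `|a|)) ^+ 2 =
    `|a| ^+ 2 + A ^+ 2 + B ^+ 2 + 2 * (A * B + A * `|a| + B * `|a|) by ring.
rewrite -[a ^+ 2]real_normK ?num_real//.
have : 0 <= A * B + A * `|a| + B * `|a| by rewrite !addr_ge0// mulr_ge0.
by lra.
Qed.

Theorem theorem4 (R : realType) (d : measure_display) (Omega : measurableType d)
    (P : probability Omega R) (V : set R) (f ft : R -> Omega -> R)
    (S : R -> R) (dw q C : R) (p : \bar R) (M N : nat)
    (dS : measure_display) (Sigma : measurableType dS) (Q : probability Sigma R)
    (Z : 'I_M -> Sigma -> Omega) (W : 'I_M -> 'I_N -> Sigma -> R) :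
  measurable V ->
  measurable_fun setT (fun x : R * Omega => f x.1 x.2) ->
  measurable_fun setT (fun x : R * Omega => ft x.1 x.2) ->
  (forall z, is_density_on V (fun v => f v z)) ->
  (forall z, is_density_on V (fun v => ft v z)) ->
  measurable_fun setT S -> (forall x, 0 <= S x) ->
  (exists B : R, forall x, S x <= B) ->
  0 < dw ->
  (forall w, V w -> (0 < 'V_P[smooth S V ft w])%E) ->
  (forall w, V w -> (0 < 'V_P[smooth S V f w])%E) ->
  (0 < M)%N -> (0 < N)%N ->
  is_sampling Q P V f Z W ->
  (1 <= p)%E -> 0 < q ->
  (LpV V p (fun w => 'E_P[f w] - 'E_P[smooth S V f w])
     <= (C * dw `^ q)%:E)%E ->
  (LpV V p (fun w =>
       (\int[Q]_s (('E_P[f w] - (estimator P S V f ft Z W w s)%:E)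
                 * ('E_P[f w] - (estimator P S V f ft Z W w s)%:E))) `^ 2^-1)
   <= LpV V p (fun w =>
         (Num.sqrt (1 - rho P S V f ft w ^+ 2) * Num.sqrt (nu2 P S V f w))%:E)
        * ((Num.sqrt (M%:R))^-1)%:E
      + LpV V p (fun w => sigma2_SM P S V f w `^ 2^-1)
        * ((Num.sqrt (N%:R))^-1)%:E
      + (C * dw `^ q)%:E)%E.
Proof.
move=> mV mf mft fd ftd mS S0 [SB hSB] dw0 Vft Vf M0 N0 QZW p1 q0 bias.
have bS : bmeas S.
  by split => //; exists SB => x; rewrite ger0_norm.
set L := fun w => (poweR _ _).
pose h w : \bar R :=
  (Num.sqrt (1 - rho P S V f ft w ^+ 2) * Num.sqrt (nu2 P S V f w))%:E.
pose sg w : \bar R := (sigma2_SM P S V f w `^ 2^-1)%E.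
pose a w : \bar R := ('E_P[f w] - 'E_P[smooth S V f w])%E.
pose IV w : \bar R := (\1_V w : R)%:E.
pose c1 : R := (Num.sqrt M%:R)^-1; pose c2 : R := (Num.sqrt N%:R)^-1.
have c10 : 0 <= c1 by rewrite invr_ge0 sqrtr_ge0.
have c20 : 0 <= c2 by rewrite invr_ge0 sqrtr_ge0.
have mIV : measurable_fun setT IV.
  by apply/measurable_EFinP; exact: measurable_indic.
have IV0 w : (0 <= IV w)%E by rewrite lee_fin.
have mh : measurable_fun setT (fun w => IV w * h w)%E.
  apply: emeasurable_funM => //; apply/measurable_EFinP.
  exact: measurable_fun_residual.
have msg : measurable_fun setT (fun w => IV w * sg w)%E.
  apply: emeasurable_funM => //.
  apply: (measurableT_comp (measurable_poweR _)).
  exact: measurable_fun_sigma2_SM.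
have ma : measurable_fun setT (fun w => IV w * a w)%E.
  by apply: emeasurable_funM => //; exact: measurable_fun_bias.
have h0 w : (0 <= IV w * h w)%E.
  by rewrite mule_ge0// lee_fin mulr_ge0 ?sqrtr_ge0.
have sg0 w : (0 <= IV w * sg w)%E by rewrite mule_ge0// poweR_ge0.
have pointwise w : V w -> (L w <= c1%:E * h w + (c2%:E * sg w + `|a w|))%E.
  move=> Vw; rewrite /L /a.
  have Ey : 'E_P[smooth S V f w]%E = (\int[P]_z smooth S V f w z)%:E.
    by rewrite unlock EFin_Rintegral//; exact: bmeas_smooth.
  have : (0 <= 'E_P[f w])%E.
    by apply: expectation_ge0 => z; have [_ + _] := fd z; exact.
  (* If the mean of [f] at [w] is [+oo], so is the bias term on the right, since the mean of the
     smoothed density is finite. *)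
  rewrite Ey; case: ('E_P[f w])%E => [e| |]//= _; last first.
    have cs0 : (0 <= c2%:E * sg w)%E by rewrite mule_ge0 ?poweR_ge0.
    rewrite [X in (_ <= X)%E](_ : _ = +oo)%E ?leey//.
    by rewrite addey// gt_eqF// (lt_le_trans _ cs0).
  under eq_integral => s _ do rewrite -EFinD -EFinM -expr2.
  (* Recorded before the integral is rewritten, so that the explicit sum is known to be nonnegative
     and its power 1/2 is a square root. *)
  have : (0 <= \int[Q]_s ((e - estimator P S V f ft Z W w s) ^+ 2)%:E)%E.
    by apply: integral_ge0 => t _; rewrite lee_fin sqr_ge0.
  rewrite (estimator_second_moment mV mf mft fd ftd bS S0 QZW M0 N0 e
    (Vft w Vw) (Vf w Vw)).
  have := sigma2_SM_ge0 P S fd w.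
  rewrite /sg /h (sigma2_SME P mV mf fd bS S0) !poweR_EFin
    !lee_fin /= => s0 tot0.
  rewrite !powR12_sqrt// -?EFinM ?abse_EFin -?EFinD ?lee_fin.
  apply: sqrtr_error_le => //.
  - by rewrite ler1n.
  - by rewrite ltr0n.
  - by apply: fine_ge0; exact/ltW/Vf.
apply: (@le_trans _ _ (Lnorm (@lebesgue_measure R) p
   (fun w => c1%:E * (IV w * h w) + (c2%:E * (IV w * sg w) +
     `|IV w * a w|))%E)).
  apply: le_Lnorm => // w; rewrite -/(IV w).
  rewrite gee0_abs ?mule_ge0 ?poweR_ge0// gee0_abs; last first.
    by rewrite !adde_ge0// mule_ge0.
  (* Off [V], where nothing is known about the variances, the indicator makes both sides 0. *)
  rewrite /IV indicE; have [/set_mem Vw|_] := boolP (w \in V).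
    by rewrite !mul1e; exact: pointwise.
  by rewrite !mul0e !mule0 abse0 !adde0.
apply: (@le_trans _ _ (Lnorm (@lebesgue_measure R) p
  (fun w => c1%:E * (IV w * h w))%E
  + (Lnorm (@lebesgue_measure R) p (fun w => c2%:E * (IV w * sg w))%E
  + Lnorm (@lebesgue_measure R) p (fun w => `|IV w * a w|)%E))%E).
  have mc1 : measurable_fun setT (fun w => c1%:E * (IV w * h w))%E.
    exact: measurable_funeM.
  have mc2 : measurable_fun setT (fun w => c2%:E * (IV w * sg w))%E.
    exact: measurable_funeM.
  have mab : measurable_fun setT (fun w => `|IV w * a w|)%E.
    exact: measurableT_comp.
  apply: le_trans (ge0_minkowski _ _ _ _ _ _) _ => //.
  - exact: emeasurable_funD.
  - by move=> w; rewrite mule_ge0.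
  - by move=> w; rewrite adde_ge0// mule_ge0.
  - apply: leeD => //; apply: ge0_minkowski => //.
    by move=> w; rewrite mule_ge0.
rewrite !ge0_LnormZl// addeA; apply: leeD.
  by rewrite /LpV [in leRHS]muleC [X in (_ <= _ + X)%E]muleC.
by apply: le_trans bias; rewrite /LpV -[leRHS]Lnorm_abse.
Qed.
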